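(* In the setting of the context, assume $S$ is infinite. Then for all sufficiently large integers $K$ with $p_K:=u+Kv\in S$, the denominator of $h(K)$ is divisible by $p_K$, and $h(J)$ is $p_K$-integral for every positive integer $J<K$. Consequently every sufficiently large prime in $S$ divides the denominator of $h(K)$ for some $K$.
   Context: $q=e^{2\pi i\tau}$, $q^s=e^{2\pi is\tau}$, $\Gamma_0(2)=\{\gamma\in\mathrm{SL}_2(\mathbf{Z}):\gamma_{21}\equiv0\bmod2\}$, $T=\begin{pmatrix}1&1\\0&1\end{pmatrix}$. $E_2=1-24\sum\sigma(n)q^n$, $E_4=1+240\sum\sigma_3(n)q^n$, $G(\tau)=-E_2(\tau)+2E_2(2\tau)$, $\mathfrak{J}=\frac{3G^2}{E_4-G^2}$, $\mathfrak{K}=64\mathfrak{J}=q^{-1}(1+O(q))\in q^{-1}\mathbf{Z}[[q]]^\times$, $D_kA=\frac{1}{2\pi i}A'-\frac{k}{12}E_2A$. Setting: $\rho:\Gamma_0(2)\to\mathrm{GL}_2(\mathbf{C})$ irreducible; $k_0$ least with $M_{k_0}(\rho)\ne0$ (holomorphic weight-$k_0$ vector-valued modular forms), $F\ne0$ in it; $a,b,c$ unique with $D_{k_0+2}D_{k_0}F+aGD_{k_0}F+(bG^2+cE_4)F=0$; $r$ a root of $r^2-(a+\frac13)r+b+4c=0$. Standing assumption: $\rho(T)$ of finite order, $c\in\mathbf{Q}$, $[\mathbf{Q}(r):\mathbf{Q}]=2$. Fix $X$ with $X\rho(T)X^{-1}=\mathrm{diag}(e^{2\pi im_1},e^{2\pi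 im_2})$ ($|m_1|\le|m_2|$); components of $XF$ are $\lambda_iq^{k_0/12+l_i}(1+O(q))$, $\lambda_i\ne0$; $A=r+l_1$, $B=r+l_2$; $A-B=u/v$, $u,v\in\mathbf{Z}$, $v>1$, $\gcd(u,v)=1$. $M$ square-free with $\mathbf{Q}(r)=\mathbf{Q}(\sqrt M)$; $S$ = odd primes $p$ with $M$ a non-residue mod $p$ and $p\equiv u\pmod v$. Writing $\mathfrak{K}^{-1}=q(1+Y)$, $Y\in q\mathbf{Z}[[q]]$, and $\mathfrak{J}^{-A}(\mathfrak{J}-1)^r:=64^{A-r}q^{A-r}(1+Y)^{A-r}(1-64\mathfrak{K}^{-1})^r$ (binomial series), $h(K)$ is defined by $\mathfrak{J}^{-A}(\mathfrak{J}-1)^r{}_2F_1(A,\frac12+A,1+A-B;\mathfrak{J}^{-1})=64^{A-r}q^{A-r}(1+\sum_{K\ge1}h(K)q^K)$, ${}_2F_1(\alpha,\beta,\gamma;z)=\sum_n\frac{(\alpha)_n(\beta)_n}{(\gamma)_nn!}z^n$. An algebraic number is $p$-integral if $p$ does not divide its denominator (least positive $N$ with $N\zeta$ an algebraic integer). *)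

(* Defs.v *)
From HB Require Import structures.
From mathcomp Require Import all_boot all_order all_algebra.
From mathcomp Require Import all_classical all_reals all_analysis.
From mathcomp Require Import complex.

Set Implicit Arguments.
Unset Strict Implicit.
Unset Printing Implicit Defensive.

Import Order.TTheory GRing.Theory Num.Theory.
Import numFieldNormedType.Exports.

Local Open Scope classical_set_scope.
Local Open Scope ring_scope.
Local Open Scope complex_scope.

Section ComplexExponential.
Variable R : realType.
Local Notation C := R[i].

Definition upper_half : set C := [set tau | 0 < complex.Im tau].

Definition expC (z : C) : C :=
  (expR (complex.Re z))%:C
    * (cos (complex.Im z) +i* sin (complex.Im z)).

Definition twopii : C := 0 +i* (2 * pi).

Definition qpow (s tau : C) : C := expC (twopii * s * tau).

(* [C^o] is [C] with the topology of its norm. *)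
Definition qpartial (a : nat -> C) (tau : C) : nat -> C^o :=
  series (fun n => a n * qpow 1 tau ^+ n : C^o).

Definition qsum (a : nat -> C) (tau : C) : C := limn (qpartial a tau).

Definition holomorphic_on_H (f : C -> C) : Prop :=
  forall tau, upper_half tau -> derivable (f : C^o -> C^o) tau 1.

End ComplexExponential.

Section Fps.
Variable F : fieldType.

(* A formal power series is its coefficient sequence. *)
Definition fps := nat -> F.

Definition fps_one : fps := fun n => (n == 0)%N%:R.
Definition fps_add (a b : fps) : fps := fun n => a n + b n.
Definition fps_scale (x : F) (a : fps) : fps := fun n => x * a n.
Definition fps_mul (a b : fps) : fps :=
  fun n => \sum_(i < n.+1) a i * b (n - i)%N.
Definition fps_exp (a : fps) (m : nat) : fps := iter m (fps_mul a) fps_one.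

(* The value a(z(q)) when z has no constant term: as z^m is then O(q^m), the
   terms m > n do not contribute to the coefficient of q^n. *)
Definition fps_comp (a z : fps) : fps :=
  fun n => \sum_(m < n.+1) a m * fps_exp z m n.

Definition pochhammer (x : F) (n : nat) : F := \prod_(i < n) (x + i%:R).

Definition gbinomial (s : F) (n : nat) : F :=
  (\prod_(i < n) (s - i%:R)) / n`!%:R.

(* (1 + z)^s, for z without constant term. *)
Definition fps_binomial (z : fps) (s : F) : fps := fps_comp (gbinomial s) z.

Definition hyp2F1 (x y w : F) : fps := fun n =>
  pochhammer x n * pochhammer y n / (pochhammer w n * n`!%:R).

Definition sigma (k n : nat) : nat := (\sum_(d <- divisors n) d ^ k)%N.

Definition E2_series : fps :=
  fun n => if n == 0%N then 1 else - 24 * (sigma 1 n)%:R.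
Definition E4_series : fps :=
  fun n => if n == 0%N then 1 else 240 * (sigma 3 n)%:R.

(* - E_2(q) + 2 E_2(q^2) *)
Definition G_series : fps := fun n =>
  - E2_series n + 2 * (if (2 %| n)%N then E2_series (n %/ 2)%N else 0).

(* 1/K = (E_4 - G^2) / (192 G^2), since K = 64 J = 192 G^2 / (E_4 - G^2);
   the constant term of G^2 is 1, so 1/G^2 = (1 + (G^2 - 1))^(-1). *)
Definition Kinv_series : fps :=
  let G2 := fps_mul G_series G_series in
  fps_scale 192^-1
    (fps_mul (fps_add E4_series (fps_scale (-1) G2))
             (fps_binomial (fps_add G2 (fps_scale (-1) fps_one)) (-1))).

(* Y = 1/(q K) - 1 *)
Definition Y_series : fps :=
  fun n => Kinv_series n.+1 - (n == 0)%N%:R.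

(* The coefficients of (1 + Y)^(A - r) (1 - 64/K)^r 2F1(A, 1/2 + A, 1 + A - B;
   1/J), with 1/J = 64/K: this is J^(-A) (J - 1)^r 2F1(A, 1/2 + A, 1 + A - B;
   1/J) stripped of its prefactor 64^(A - r) q^(A - r). *)
Definition hcoef (A B r : F) : fps :=
  fps_mul
    (fps_mul (fps_binomial Y_series (A - r))
             (fps_binomial (fps_scale (- 64) Kinv_series) r))
    (fps_comp (hyp2F1 A (2^-1 + A) (1 + A - B)) (fps_scale 64 Kinv_series)).

End Fps.

Section ModularForms.
Variable R : realType.
Local Notation C := R[i].

Definition SL2Z : set 'M[int]_2 := [set g | \det g = 1].
Definition Gamma0_2 : set 'M[int]_2 :=
  [set g | SL2Z g /\ (2 %| g 1%R 0%R)%Z].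

Definition Tmx : 'M[int]_2 := \matrix_(i, j) (i <= j)%N%:R.

Definition autfactor (g : 'M[int]_2) (tau : C) : C :=
  (g 1 0)%:~R * tau + (g 1 1)%:~R.
Definition moebius (g : 'M[int]_2) (tau : C) : C :=
  ((g 0 0)%:~R * tau + (g 0 1)%:~R) / autfactor g tau.

Definition slash (k : int) (g : 'M[int]_2) (F : C -> 'cV[C]_2) (tau : C) :
    'cV[C]_2 :=
  autfactor g tau ^ (- k) *: F (moebius g tau).

(* Only the restriction of [rho] to [Gamma0_2] is meaningful. *)
Definition is_representation (rho : 'M[int]_2 -> 'M[C]_2) : Prop :=
  (forall g, Gamma0_2 g -> rho g \in unitmx) /\
  (forall g g', Gamma0_2 g -> Gamma0_2 g' ->
     rho (g *m g') = rho g *m rho g').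

Definition is_irreducible (rho : 'M[int]_2 -> 'M[C]_2) : Prop :=
  forall W : {vspace 'cV[C]_2},
    (forall g, Gamma0_2 g -> forall w, w \in W -> rho g *m w \in W) ->
    W = 0%VS \/ W = fullv.

(* Holomorphy at the cusps is moderate growth of every SL_2(Z)-translate in
   vertical strips: rho is arbitrary at the cusp 0, so the expansions there may
   involve non-real exponents and powers of log q, and moderate growth says that
   no exponent has negative real part. *)
Definition moderate_growth (F : C -> 'cV[C]_2) : Prop :=
  forall (i : 'I_2) (b : R), exists (N : nat) (c : R),
    forall tau : C, 1 <= complex.Im tau -> `|complex.Re tau| <= b ->
      `|F tau i 0| <= (c * complex.Im tau ^+ N)%:C.

Definition is_vvmf (rho : 'M[int]_2 -> 'M[C]_2) (k : int)
    (F : C -> 'cV[C]_2) : Prop :=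
  [/\ forall i, holomorphic_on_H (fun tau => F tau i 0),
      forall g tau, Gamma0_2 g -> upper_half tau ->
        slash k g F tau = rho g *m F tau
    & forall g, SL2Z g -> moderate_growth (slash k g F)].

(* A form is a function on the upper half-plane; the values of [F] elsewhere
   are irrelevant. *)
Definition nonzero_on_H (F : C -> 'cV[C]_2) : Prop :=
  exists2 tau, upper_half tau & F tau != 0.

Definition is_least_weight (rho : 'M[int]_2 -> 'M[C]_2) (k0 : int) : Prop :=
  (exists2 F, is_vvmf rho k0 F & nonzero_on_H F) /\
  (forall k F, is_vvmf rho k F -> nonzero_on_H F -> k0 <= k).

Definition E2 (tau : C) : C := qsum (@E2_series C) tau.
Definition E4 (tau : C) : C := qsum (@E4_series C) tau.
Definition G (tau : C) : C := - E2 tau + 2 * E2 (2 * tau).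

Definition D (k : int) (f : C -> C) (tau : C) : C :=
  (twopii R)^-1 * derive1 (f : C -> C^o) tau - k%:~R / 12 * E2 tau * f tau.

Definition satisfies_ode (k0 : int) (a b c : C) (F : C -> 'cV[C]_2) : Prop :=
  forall (i : 'I_2) (tau : C), upper_half tau ->
    let f := fun z => F z i 0 in
    D (k0 + 2) (D k0 f) tau + a * G tau * D k0 f tau
      + (b * G tau ^+ 2 + c * E4 tau) * f tau = 0.

(* f = lam q^s (1 + O(q)) *)
Definition has_leading_term (f : C -> C) (lam s : C) : Prop :=
  exists2 a : nat -> C, a 0%N = 1 &
    forall tau, upper_half tau ->
      cvgn (qpartial a tau) /\ f tau = lam * qpow s tau * qsum a tau.

End ModularForms.

Section Arithmetic.
Variable R : realType.
Local Notation C := R[i].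

Definition evalQ (p : {poly rat}) (x : C) : C := (map_poly ratr p).[x].

Definition Qadjoin (x : C) : set C :=
  [set z | exists p d : {poly rat}, evalQ d x != 0 /\ z = evalQ p x / evalQ d x].

Definition Qdim (E : set C) (n : nat) : Prop :=
  exists e : 'I_n -> C,
    (forall z, E z <-> exists t : 'I_n -> rat, z = \sum_i ratr (t i) * e i) /\
    (forall t : 'I_n -> rat,
       \sum_i ratr (t i) * e i = 0 -> forall i, t i = 0).

Definition squarefree (M : int) : Prop :=
  forall d : int, (d ^+ 2 %| M)%Z -> `|d| = 1.

(* Multiples of p are squares mod p, hence are not non-residues. *)
Definition nonresidue (M : int) (p : nat) : Prop :=
  ~ exists x : int, (x ^+ 2 = M %[mod p%:Z])%Z.

Definition primesS (M u v : int) : set nat :=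
  [set p | [/\ prime p, odd p, nonresidue M p & (p%:Z = u %[mod v])%Z]].

Definition algebraic_integer (z : C) : Prop := integralOver (intr : int -> C) z.

Definition is_denominator (z : C) (N : nat) : Prop :=
  [/\ (0 < N)%N, algebraic_integer (N%:R * z)
    & forall N', (0 < N')%N -> algebraic_integer (N'%:R * z) -> (N <= N')%N].

Definition divides_denominator (p : nat) (z : C) : Prop :=
  exists2 N, is_denominator z N & (p %| N)%N.

Definition p_integral (p : nat) (z : C) : Prop :=
  exists2 N, is_denominator z N & ~~ (p %| N)%N.

End Arithmetic.

(* Main.v *)
(** [rho(T)] has finite order [n], so each component [f] of [XF] is invariant
    under [tau |-> tau + n]; comparing with [f = lambda q^s (1 + O(q))] gives
    [n s] in Z.  Hence the [l_i] are rational and [A = r + l_1] is an irrational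
    element of Q(sqrt M).  For a large prime [p = u + K v] at which [M] is a
    non-residue, all [A + i] and [1/2 + A + i] are [p]-adic units, while
    [(1 + A - B)_n = v^-n (u + v) ... (u + n v)] is a [p]-adic unit for [n < K]
    and exactly divisible by [p] for [n = K].  All other ingredients of [h(J)],
    [J <= K], are [p]-integral because [K < p], so [h(K)] is a [p]-integral
    number plus a [p]-adic unit divided by [p]. *)
Require Import Defs.
From HB Require Import structures.
From mathcomp Require Import all_boot all_order all_algebra.
From mathcomp Require Import all_classical all_reals all_analysis.
From mathcomp Require Import complex.
From mathcomp Require Import ring lra zify.
Import Order.TTheory GRing.Theory Num.Theory.
Import numFieldNormedType.Exports.
Local Open Scope classical_set_scope.
Local Open Scope ring_scope.
Local Open Scope complex_scope.

Set Implicit Arguments.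
Unset Strict Implicit.
Unset Printing Implicit Defensive.

(** * Exponents of periodic q-expansions *)

Section Exponential.
Variable R : realType.
Local Notation C := R[i].

Lemma expCD (z w : C) : expC (z + w) = expC z * expC w.
Proof.
case: z w => [x y] [x' y']; rewrite /expC /= expRD cosD sinD.
by apply/eqP; rewrite eq_complex /=; apply/andP; split; apply/eqP; ring.
Qed.

Lemma expC_neq0 (z : C) : expC z != 0.
Proof.
have e0 : expC (0 : C) = 1.
  by rewrite /expC /= expR0 cos0 sin0 mul1r.
have := expCD z (- z); rewrite subrr e0 => /eqP.
by apply: contraTneq => ->; rewrite mul0r oner_eq0.
Qed.

Lemma expC_twopii_nat (n : nat) : expC (twopii R * n%:R) = 1.
Proof.
have -> : twopii R * n%:R = 0 +i* (0 + pi *+ 2 *+ n).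
  rewrite -[n%:R](rmorph_nat (@real_complex R)) /twopii /=.
  apply/eqP; rewrite eq_complex /=; apply/andP; split; apply/eqP; first ring.
  by rewrite -mulr_natr -[pi *+ 2]mulr_natr; ring.
by rewrite /expC /= (periodicn (@cosD2pi R)) (periodicn (@sinD2pi R)) expR0
  cos0 sin0 mul1r.
Qed.

(** Evenness reduces to x >= 0, and removing full turns leaves [y] in [0, 2 pi). If [y] were
    nonzero, sin (y / 2) would be positive, and cos y = 1 - 2 sin(y / 2)^2 would be less than 1. *)
Lemma cos_eq1 (x : R) : cos x = 1 -> exists k : int, x = pi *+ 2 * k%:~R.
Proof.
have pi2 : 0 < (pi *+ 2 : R) by rewrite pmulrn_lgt0 // pi_gt0.
wlog x0 : x / 0 <= x => [hw|].
  have [/hw//|/ltW x0 cx] := leP 0 x.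
  case: (hw (- x)); rewrite ?oppr_ge0 ?cosN // => k xk.
  by exists (- k); rewrite rmorphN mulrN -xk opprK.
move=> cx; pose n := Num.trunc (x / (pi *+ 2)).
have /andP[n1 n2] := truncn_itv (divr_ge0 x0 (ltW pi2)).
pose y := x - pi *+ 2 *+ n.
have y0 : 0 <= y by rewrite subr_ge0 -mulr_natl -ler_pdivlMr.
have y2 : y < pi *+ 2.
  by rewrite ltrBlDr -mulrS -mulr_natl -ltr_pdivrMr.
exists n%:Z; rewrite -pmulrn mulr_natr; apply/eqP; rewrite -subr_eq0 -/y.
apply: contraTT isT => yn0.
have cy : cos y = 1 by rewrite -(periodicn (@cosD2pi R) n) subrK.
have : 0 < sin (y / 2).
  have y_gt0 : 0 < y by rewrite lt_neqAle eq_sym yn0.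
  apply: sin_gt0_pi; rewrite divr_gt0 //= ltr_pdivrMr // mulr_natr //.
have : cos (y / 2 *+ 2) = 1 by rewrite -mulr_natr divfK.
rewrite cos_mulr2n cos2sin2 -mulr_natr => h hs.
have : 0 < sin (y / 2) ^+ 2 by rewrite exprn_gt0.
lra.
Qed.

(** For s = x + iy, [t] is the angle 2 pi x and [w] the real exponent - 2 pi y. The vanishing
    imaginary part forces sin t = 0, positivity of the real part leaves cos t = 1, so x is an
    integer, and then exp w = 1 gives y = 0. *)
Lemma expC_eq1 (s : C) : expC (twopii R * s) = 1 -> exists k : int, s = k%:~R.
Proof.
case: s => x y; rewrite /expC /twopii /= => /eqP; rewrite eq_complex /=.
set t := 0 * y + 2 * pi * x => /andP[/eqP hc /eqP hs].
set w := (X in expR X) in hc hs.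
have ew := expR_gt0 w.
have st : sin t = 0.
  have /eqP : expR w * sin t = 0 by lra.
  by rewrite mulf_eq0 gt_eqF //= => /eqP.
have ct : 0 < cos t by rewrite -(pmulr_rgt0 _ ew); lra.
have c1 : cos t = 1.
  have := cos2Dsin2 t; rewrite st expr0n addr0 => /eqP.
  rewrite sqrf_eq1 => /orP[/eqP//|/eqP c1]; lra.
have w0 : w = 0.
  by apply: expR_inj; rewrite expR0; move: hc; rewrite c1; lra.
have [k tk] := cos_eq1 c1.
have pi0 : 2 * pi != 0 :> R by rewrite mulf_neq0 ?pnatr_eq0 // gt_eqF ?pi_gt0.
exists k; rewrite -(rmorph_int (@real_complex R)).
apply/eqP; rewrite eq_complex /=; apply/andP; split.
  rewrite -(inj_eq (mulfI pi0)); apply/eqP; move: tk.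
  rewrite /t mul0r add0r => ->.
  by rewrite mulr_natl.
rewrite -(inj_eq (mulfI pi0)); apply/eqP; move: w0; rewrite /w; lra.
Qed.

Lemma qpowD (s tau t : C) :
  qpow s (tau + t) = qpow s tau * expC (twopii R * s * t).
Proof. by rewrite /qpow -expCD mulrDr. Qed.

Lemma qsumDn (a : nat -> C) (tau : C) (n : nat) :
  qsum a (tau + n%:R) = qsum a tau.
Proof. by rewrite /qsum /qpartial qpowD mulr1 expC_twopii_nat mulr1. Qed.

End Exponential.

(** * Rationality of leading exponents, and translation by T *)

Section LeadingExponents.
Variable R : realType.
Local Notation C := R[i].
Lemma qpow1_imag (t : R) : qpow 1 (0 +i* t) = (expR (- (2 * pi * t)))%:C.
Proof.
rewrite /qpow mulr1 /expC /twopii /= !mul0r mulr0 sub0r addr0 cos0 sin0.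
by rewrite mulr1.
Qed.

Lemma geometric_half_sum (e : R) n : 0 <= e -> e <= 2^-1 ->
  \sum_(i < n) e ^+ i.+1 <= 2 * e.
Proof.
(* The remainder 2 e^(n+1) is kept so that the induction closes. *)
move=> e0 e2; suff : \sum_(i < n) e ^+ i.+1 <= 2 * e - 2 * e ^+ n.+1.
  by have := exprn_ge0 n.+1 e0; lra.
elim: n => [|n IHn]; first by rewrite big_ord0 expr1 subrr.
rewrite big_ord_recr /=; have := exprn_ge0 n.+1 e0.
rewrite [e ^+ n.+2]exprS; nra.
Qed.

(* On the imaginary axis [qsum a tau] tends to [a 0] at the cusp. *)
Lemma qsum_neq0 (a : nat -> C) : a 0%N = 1 ->
  (forall tau, upper_half tau -> cvgn (qpartial a tau)) ->
  exists2 tau, upper_half tau & qsum a tau != 0.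
Proof.
move=> a0 cva.
have Hi : upper_half (0 +i* 1 : C) by rewrite /upper_half /= ltr01.
(* Convergence at i bounds the terms of the series there by some [M]; higher on the imaginary axis
   the n-th term is damped by a further factor [e ^+ n]. *)
have := cva _ Hi => /cvg_series_cvg_0 /cvgP /cvg_seq_bounded.
rewrite /bounded_fun => -[M0 [M0r /(_ (M0 + 1))]].
rewrite ltrDl ltr01 => /(_ isT) Mb.
have [M [M_ge0 MP]] : exists M : R, 0 <= M /\
    forall n, `|a n * qpow 1 (0 +i* 1) ^+ n| <= M%:C.
  have M0E : M0 + 1 = (complex.Re (M0 + 1))%:C.
    by apply/esym/RRe_real; rewrite realD.
  exists (complex.Re (M0 + 1)); rewrite -M0E.
  split; last by move=> n; apply: Mb.
  have := le_trans (normr_ge0 _) (Mb 0%N I).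
  by rewrite M0E lecR.
(* With this [t], the estimate e (1 + t) <= 1 yields both e <= 1/2 and 2 M e <= 1/2. *)
pose t := 4 * M + 2; have t0 : 0 < t by rewrite /t; lra.
pose e := expR (- (2 * pi * t)).
have e_gt0 : 0 < e by exact: expR_gt0.
have e_le : e * (1 + t) <= 1.
  have h := expR_ge1Dx (2 * pi * t).
  have hp : 1 <= 2 * pi :> R by have := pi_ge2 R; lra.
  have e1 : e * expR (2 * pi * t) = 1 by rewrite -expRD addNr expR0.
  rewrite -[leRHS]e1; apply: ler_wpM2l; first exact: ltW.
  by apply: le_trans h; rewrite lerD2l ler_peMl // ltW.
have e_half : e <= 2^-1 by rewrite /t in e_le; nra.
have Me : M * (2 * e) <= 2^-1 by rewrite /t in e_le; nra.
exists (0 +i* (1 + t)); first by rewrite /upper_half /=; lra.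
(* If the sum were 0, some partial sum 1 + S would have modulus below 1/2, whereas the geometric
   bound gives |S| <= 1/2. *)
apply/eqP => q0.
have Ht : upper_half (0 +i* (1 + t) : C) by rewrite /upper_half /=; lra.
have cv : qpartial a (0 +i* (1 + t)) n @[n --> \oo] --> (0 : C^o).
  by rewrite -q0; apply: cva.
have /cvgrPdist_lt /(_ 2^-1) := cv.
rewrite invr_gt0 ltr0n => /(_ isT) [n _ /(_ n.+1 (leqnSn n))] /=.
rewrite sub0r normrN /qpartial /series /= big_mkord big_ord_recl a0 expr0 mulr1.
set S := \sum_(i < n) _ => lt_half.
have S_le : `|S| <= 2^-1.
  apply: le_trans (ler_norm_sum _ _ _) _.
  apply: (@le_trans _ _ (\sum_(i < n) (M * e ^+ i.+1)%:C)).
    apply: ler_sum => i _; rewrite /bump /=.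
    have -> : qpow 1 (0 +i* (1 + t)) = qpow 1 (0 +i* 1) * e%:C :> C.
      rewrite !qpow1_imag -rmorphM /= -expRD; congr (expR _)%:C; ring.
    rewrite exprMn mulrA normrM rmorphM /=; apply: ler_pM => //.
    by rewrite -rmorphXn /= ger0_norm // lecR exprn_ge0 // ltW.
  rewrite -rmorph_sum /= -mulr_sumr.
  have -> : 2^-1 = (2^-1)%:C :> C by rewrite fmorphV rmorph_nat.
  rewrite lecR; apply: le_trans _ Me; apply: ler_wpM2l => //.
  by apply: geometric_half_sum => //; apply: ltW.
have : `|1 : C| <= `|1 + S| + `|S|.
  by rewrite -{1}(addrK S 1) (le_trans (ler_normB _ _)).
rewrite normr1 => /le_lt_trans /(_ (ltr_leD lt_half S_le)).
by rewrite -[2^-1]mul1r -splitr ltxx.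
Qed.

(** The power series in q is unchanged by tau -> tau + n. At a point where it does not vanish it
    cancels, leaving exp(2 pi i s n) = 1, so n s is an integer. *)
Lemma leading_exponent_rational (f : C -> C) (lam s : C) (n : nat) :
  (0 < n)%N -> lam != 0 -> has_leading_term f lam s ->
  (forall tau, upper_half tau -> f (tau + n%:R) = f tau) ->
  exists q : rat, s = ratr q.
Proof.
move=> n0 lam0 [a a0 fa] fn.
have [tau Htau qn0] := qsum_neq0 a0 (fun t h => (fa t h).1).
have Htau' : upper_half (tau + n%:R).
  rewrite /upper_half /= -[n%:R](rmorph_nat (@real_complex R)) raddfD /= addr0.
  exact: Htau.
have := fn tau Htau.
rewrite (fa tau Htau).2 (fa _ Htau').2 qsumDn => /(mulIf qn0) /(mulfI lam0).
rewrite qpowD -[RHS]mulr1 => /(mulfI (expC_neq0 _)).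
rewrite -mulrA => /expC_eq1 [k sk].
exists (k%:~R / n%:R); rewrite fmorph_div /= ratr_int ratr_nat -sk mulfK //.
by rewrite pnatr_eq0 -lt0n.
Qed.

Lemma vvmf_translation (rho : 'M[int]_2 -> 'M[C]_2) k F n tau :
  is_vvmf rho k F -> upper_half tau -> F (tau + n%:R) = rho Tmx ^+ n *m F tau.
Proof.
move=> [_ Fmod _] Htau.
have GT : Gamma0_2 Tmx.
  split; last by rewrite !mxE.
  rewrite /SL2Z /= -det_tr det_trig; last first.
    by apply/is_trig_mxP => i j ij; rewrite !mxE leqNgt ij.
  by apply: big1 => i _; rewrite !mxE leqnn.
have FT t : upper_half t -> F (t + 1) = rho Tmx *m F t.
  move=> Ht; rewrite -(Fmod _ _ GT Ht) /slash /moebius.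
  have -> : autfactor Tmx t = 1 by rewrite /autfactor !mxE /=; ring.
  by rewrite exp1rz scale1r divr1 !mxE /=; congr F; ring.
have Hn m : upper_half (tau + m%:R).
  rewrite /upper_half /= -[m%:R](rmorph_nat (@real_complex R)) raddfD /= addr0.
  exact: Htau.
elim: n => [|n IHn]; first by rewrite addr0 expr0 mul1mx.
by rewrite -natr1 addrA FT // IHn exprS mulmxA.
Qed.
End LeadingExponents.

(** * Numbers integral at p *)

(** Integrality at p witnessed by any multiplier prime to p, not the least one; in this form closure
    under ring operations is immediate. *)
Definition local_integral (R : realType) (p : nat) (z : R[i]) : Prop :=
  exists2 N : nat, ~~ (p %| N)%N & algebraic_integer (N%:R * z).

Section LocalIntegral.
Variables (R : realType) (p : nat).
Hypothesis p_prime : prime p.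
Local Notation C := R[i].
Implicit Types (z w : C).

Lemma local_integralD z w :
  local_integral p z -> local_integral p w -> local_integral p (z + w).
Proof.
move=> [N pN zN] [N' pN' wN']; exists (N * N')%N.
  by rewrite Euclid_dvdM // negb_or pN.
have -> : (N * N')%:R * (z + w) = N'%:R * (N%:R * z) + N%:R * (N'%:R * w).
  by rewrite natrM; ring.
by apply: integral_add; apply: integral_mul => //; apply: integral_nat.
Qed.

Lemma local_integralM z w :
  local_integral p z -> local_integral p w -> local_integral p (z * w).
Proof.
move=> [N pN zN] [N' pN' wN']; exists (N * N')%N.
  by rewrite Euclid_dvdM // negb_or pN.
have -> : (N * N')%:R * (z * w) = (N%:R * z) * (N'%:R * w).
  by rewrite natrM; ring.
exact: integral_mul.
Qed.

Lemma algebraic_local_integral z : algebraic_integer z -> local_integral p z.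
Proof. by move=> zA; exists 1%N; rewrite ?Euclid_dvd1 // mul1r. Qed.

Lemma local_integral_int (n : int) : local_integral p (n%:~R : C).
Proof. exact/algebraic_local_integral/integral_id. Qed.

Lemma local_integral_nat (n : nat) : local_integral p (n%:R : C).
Proof. exact/algebraic_local_integral/integral_nat. Qed.

Lemma local_integralN z : local_integral p z -> local_integral p (- z).
Proof.
move=> zp; rewrite -mulN1r; apply: local_integralM zp.
exact: (local_integral_int (-1)).
Qed.

Lemma local_integral_sum n (f : 'I_n -> C) :
  (forall i, local_integral p (f i)) -> local_integral p (\sum_i f i).
Proof.
move=> fp; elim/big_ind: _ => //; last exact: local_integralD.
exact: (local_integral_nat 0).
Qed.

Lemma local_integral_prod n (f : 'I_n -> C) :
  (forall i, local_integral p (f i)) -> local_integral p (\prod_i f i).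
Proof.
move=> fp; elim/big_ind: _ => //; last exact: local_integralM.
exact: (local_integral_nat 1).
Qed.

Lemma local_integralX n z : local_integral p z -> local_integral p (z ^+ n).
Proof.
move=> zp; elim: n => [|n IHn]; first exact: (local_integral_nat 1).
by rewrite exprS; apply: local_integralM.
Qed.

Lemma local_integralV_nat (n : nat) :
  ~~ (p %| n)%N -> local_integral p (n%:R^-1 : C).
Proof.
move=> pn; exists n => //; rewrite divff; first exact: integral1.
by rewrite pnatr_eq0; apply: contraNneq pn => ->.
Qed.

Lemma local_integralV_int (n : int) :
  ~~ (p %| `|n|)%N -> local_integral p (n%:~R^-1 : C).
Proof.
case: n => n /= pn; first exact: local_integralV_nat.
rewrite NegzE mulrNz invrN; apply: local_integralN.
exact: local_integralV_nat.
Qed.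

(** If N / p is a root of a monic integer polynomial of degree n, clearing denominators shows that p
    divides N^n, hence N. *)
Lemma not_local_integralV_prime : ~ local_integral p (p%:R^-1 : C).
Proof.
have p0 : (p%:R : C) != 0 by rewrite pnatr_eq0 -lt0n prime_gt0.
move=> [N pN [P Pmonic]]; rewrite /root => /eqP Proot.
have [n szP] : {n | size P = n.+1}.
  by exists (size P).-1; rewrite prednK // size_poly_gt0 monic_neq0.
have Pn : P`_n = 1 by move/monicP: Pmonic; rewrite /lead_coef szP.
(* This is the equation times p^n, with one factor p extracted from every lower term; since i < n,
   the exponent [(n - i).-1] is not truncated. *)
have : (N%:Z ^+ n + p%:Z * \sum_(i < n) P`_i * N%:Z ^+ i * p%:Z ^+ (n - i).-1)
    = 0.
  apply/eqP; rewrite -(intr_eq0 C); apply/eqP.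
  have := congr1 (fun z => z * p%:R ^+ n) Proot.
  rewrite mul0r => <-.
  rewrite horner_coef size_map_inj_poly ?szP //; last exact: intr_inj.
  rewrite big_ord_recr /= coef_map Pn /= mulr1z mul1r mulrDl addrC rmorphD /=.
  congr (_ + _); last by rewrite expr_div_n divfK ?expf_neq0 // rmorphXn.
  rewrite mulr_sumr mulr_suml rmorph_sum /=; apply: eq_bigr => i _.
  rewrite coef_map /= !rmorphM !rmorphXn /= -!pmulrn.
  have -> : p%:R ^+ n = p%:R * p%:R ^+ (n - i).-1 * p%:R ^+ i :> C.
    rewrite -exprS prednK ?subn_gt0 // -exprD subnK // ltnW //.
  by rewrite expr_div_n; field; rewrite expf_neq0.
move/eqP; rewrite addr_eq0 => /eqP E.
have : (p%:Z %| N%:Z ^+ n)%Z by rewrite E -mulrN dvdz_mulr.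
by rewrite dvdzE abszX /= Euclid_dvdX // (negbTE pN).
Qed.

(** The integers n with n z integral form an ideal, generated by its least positive element: the
    remainder of n modulo N again belongs to it. *)
Lemma is_denominator_dvd z (N n : nat) :
  is_denominator z N -> algebraic_integer (n%:R * z) -> (N %| n)%N.
Proof.
move=> [N0 zN minN] zn; rewrite /dvdn.
apply: contraTT (ltn_pmod n N0); rewrite -lt0n -leqNgt => r0.
apply: minN => //.
have -> : (n %% N)%:R * z = n%:R * z - (n %/ N)%:R * (N%:R * z).
  rewrite {2}(divn_eq n N) natrD natrM; ring.
by apply: integral_sub => //; apply: integral_mul => //; apply: integral_nat.
Qed.

Lemma is_denominator_exists z (n : nat) :
  (0 < n)%N -> algebraic_integer (n%:R * z) -> exists N, is_denominator z N.
Proof.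
move=> n0 zn.
have ex : exists N, (0 < N)%N && `[< algebraic_integer (N%:R * z) >].
  by exists n; rewrite n0; apply/asboolP.
case: (ex_minnP ex) => N /andP[N0 /asboolP zN] minN.
exists N; split=> // N' N'0 zN'; apply: minN.
by rewrite N'0; apply/asboolP.
Qed.

Lemma local_integral_p_integral z : local_integral p z -> p_integral p z.
Proof.
move=> [n pn zn].
have n0 : (0 < n)%N by rewrite lt0n; apply: contraNneq pn => ->.
have [N dN] := is_denominator_exists n0 zn.
exists N => //; apply: contra pn => pN.
exact: dvdn_trans pN (is_denominator_dvd dN zn).
Qed.

(** A least denominator prime to p would itself witness integrality at p. Integrality of p z ensures
    that a denominator exists. *)
Lemma not_local_integral_divides_denominator z :
  local_integral p (p%:R * z) -> ~ local_integral p z ->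
  divides_denominator p z.
Proof.
move=> [n pn zn] nz.
have n0 : (0 < n)%N by rewrite lt0n; apply: contraNneq pn => ->.
have [N dN] : exists N, is_denominator z N.
  apply: (@is_denominator_exists z (n * p)).
    by rewrite muln_gt0 n0 prime_gt0.
  by rewrite natrM -mulrA.
exists N => //; apply: contra_notT nz => pN.
by exists N => //; case: dN.
Qed.

Lemma local_integral_sqrt (M : int) (s : C) :
  s ^+ 2 = M%:~R -> local_integral p s.
Proof.
move=> sM; apply: algebraic_local_integral.
apply: (integral_root_monic (p := 'X^2 - (M%:~R)%:P)).
- exact: monicXnsubC.
- by rewrite rootE !hornerE sM subrr.
- apply/integral_poly => i; rewrite coefB coefXn coefC.
  apply: integral_sub; first exact: integral_nat.
  by case: ifP => _; [exact: integral_id | exact: mxpoly.integral0].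
Qed.

Lemma local_integral_rat (q : rat) :
  ~~ (p %| `|denq q|)%N -> local_integral p (ratr q : C).
Proof.
move=> pq; apply: local_integralM; first exact: local_integral_int.
exact: local_integralV_int.
Qed.

(* [p] is inert in Q(sqrt M), so it divides the norm [x ^+ 2 - M * y ^+ 2] only
   if it divides [y]. *)
Lemma local_integralV_quadratic (M x y : int) (s : C) :
  nonresidue M p -> s ^+ 2 = M%:~R -> ~~ (p %| `|y|)%N ->
  x%:~R + y%:~R * s != 0 /\ local_integral p (x%:~R + y%:~R * s)^-1.
Proof.
move=> nonM sM py.
have pnorm : ~~ (p %| `|(x ^+ 2 - M * y ^+ 2)%R|)%N.
  apply: contra_notN nonM => pnorm.
  (* Here a p + b y = 1, so b inverts y modulo p, and x^2 = M y^2 modulo p makes x b a square root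
     of M. *)
  have /coprimezP[[a b] /= ab] : coprimez p y.
    by rewrite coprimezE /= prime_coprime.
  exists (x * b).
  apply/eqP; rewrite eqz_mod_dvd.
  have /dvdzP[k Ek] : (p%:Z %| (x ^+ 2 - M * y ^+ 2))%Z by rewrite dvdzE.
  apply/dvdzP; exists (b ^+ 2 * k + M * a * (a * p%:Z - 2)).
  have eb : b * y = 1 - a * p%:Z by rewrite -ab; ring.
  have -> : (x * b) ^+ 2 - M
      = b ^+ 2 * (x ^+ 2 - M * y ^+ 2) + M * ((b * y) ^+ 2 - 1).
    by ring.
  by rewrite Ek eb; ring.
have norm0 : (x ^+ 2 - M * y ^+ 2)%:~R != 0 :> C.
  by rewrite intr_eq0; apply: contraNneq pnorm => ->.
(* The inverse is the conjugate divided by the norm, which is prime to p. *)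
have normE : (x%:~R + y%:~R * s) * (x%:~R - y%:~R * s)
    = (x ^+ 2 - M * y ^+ 2)%:~R.
  rewrite rmorphB !rmorphM /= -sM; ring.
have /andP[z0 z'0] : (x%:~R + y%:~R * s != 0) && (x%:~R - y%:~R * s != 0).
  by rewrite -negb_or -mulf_eq0 normE.
split=> //.
have -> : (x%:~R + y%:~R * s)^-1
    = (x%:~R - y%:~R * s) * (x ^+ 2 - M * y ^+ 2)%:~R^-1.
  by rewrite -normE invfM mulrCA divff // mulr1.
apply: local_integralM; last exact: local_integralV_int.
apply/local_integralD/local_integralN/local_integralM;
  try exact: local_integral_int.
exact: local_integral_sqrt sM.
Qed.

End LocalIntegral.

(** * Coefficients of formal power series *)

Section FpsCoefficients.
Variable F : fieldType.
Implicit Types a b z : fps F.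

Lemma fps_exp_valuation a m n : a 0%N = 0 -> (n < m)%N -> fps_exp a m n = 0.
Proof.
move=> a0; elim: m n => // m IHm n; rewrite ltnS => nm.
rewrite /fps_exp iterS /fps_mul big_ord_recl a0 mul0r add0r big1 // => i _.
rewrite -/(fps_exp a m) IHm ?mulr0 //=.
by rewrite /bump /=; have := ltn_ord i; lia.
Qed.

Lemma fps_exp_leading a m : a 0%N = 0 -> fps_exp a m m = a 1%N ^+ m.
Proof.
move=> a0; elim: m => // m IHm.
rewrite /fps_exp iterS /fps_mul !big_ord_recl a0 mul0r add0r big1 => [|i _].
  by rewrite addr0 -/(fps_exp a m) /= /bump /= subn1 /= IHm exprS.
rewrite -/(fps_exp a m) fps_exp_valuation ?mulr0 //.
by rewrite /= /bump /=; have := ltn_ord i; lia.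
Qed.

Lemma fps_binomial0 z s : fps_binomial z s 0%N = 1.
Proof.
rewrite /fps_binomial /fps_comp big_ord_recl big_ord0 addr0 /gbinomial big_ord0.
by rewrite /fps_exp /= /fps_one /= fact0 divr1 mulr1.
Qed.

Section Closure.
Variable S : F -> Prop.
Hypotheses (S_nat : forall n : nat, S n%:R)
  (S_sum : forall n (f : 'I_n -> F), (forall i, S (f i)) -> S (\sum_i f i))
  (S_mul : forall x y, S x -> S y -> S (x * y)).

(** Only indices up to n are controlled, because the series used below are integral at p only in low
    degree; this suffices, as coefficient i of a product involves no index above i. *)
Lemma fps_mul_closed n a b :
  (forall i, (i <= n)%N -> S (a i)) -> (forall i, (i <= n)%N -> S (b i)) ->
  forall i, (i <= n)%N -> S (fps_mul a b i).
Proof.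
move=> Sa Sb i le_in; apply: S_sum => j; apply: S_mul.
  by apply: Sa; have := ltn_ord j; lia.
by apply: Sb; lia.
Qed.

Lemma fps_exp_closed n m a :
  (forall i, (i <= n)%N -> S (a i)) ->
  forall i, (i <= n)%N -> S (fps_exp a m i).
Proof.
move=> Sa; elim: m => [|m IHm] i le_in; first exact: S_nat.
exact: fps_mul_closed Sa IHm i le_in.
Qed.

Lemma fps_comp_closed n a z :
  (forall i, (i <= n)%N -> S (a i)) -> (forall i, (i <= n)%N -> S (z i)) ->
  forall i, (i <= n)%N -> S (fps_comp a z i).
Proof.
move=> Sa Sz i le_in; apply: S_sum => j; apply: S_mul.
  by apply: Sa; have := ltn_ord j; lia.
exact: fps_exp_closed le_in.
Qed.

End Closure.
End FpsCoefficients.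

(** * The expansion 1/K = q + O(q^2) *)

Section KinvCoefficients.
Variable F : numFieldType.

Lemma G_series0 : @G_series F 0%N = 1.
Proof. by rewrite /G_series /E2_series /=; ring. Qed.

Lemma G_series1 : @G_series F 1%N = 24.
Proof.
by rewrite /G_series /E2_series /sigma /= big_seq1 mulr0 addr0; ring.
Qed.

Lemma Kinv_series0 : @Kinv_series F 0%N = 0.
Proof.
rewrite /Kinv_series /fps_scale /fps_add /fps_mul !big_ord_recl !big_ord0 /=.
by rewrite G_series0 /E4_series /=; ring.
Qed.

(** In degree 1, E_4 contributes 240 and G^2 contributes 2 * 24 = 48; the difference 192 cancels the
    normalising factor. *)
Lemma Kinv_series1 : @Kinv_series F 1%N = 1.
Proof.
rewrite /Kinv_series {1}/fps_scale {1}/fps_mul !big_ord_recl !big_ord0 /=.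
rewrite fps_binomial0 /fps_add /fps_scale /fps_mul !big_ord_recl !big_ord0 /=.
rewrite G_series0 G_series1 /E4_series /= /sigma big_seq1 /=.
by field.
Qed.

End KinvCoefficients.

(** * The denominators of h(K) *)

Section HcoefDenominators.
Variables (R : realType) (p : nat).
Hypothesis p_prime : prime p.
Local Notation C := R[i].

Lemma prime_ndvd_fact (m : nat) : (m < p)%N -> ~~ (p %| m`!)%N.
Proof.
elim: m => [|m IHm] mp; first by rewrite fact0 Euclid_dvd1.
by rewrite factS Euclid_dvdM // negb_or IHm 1?ltnW // gtnNdvd.
Qed.

Lemma local_integral_gbinomial (s : C) (m : nat) :
  (m < p)%N -> local_integral p s -> local_integral p (gbinomial s m).
Proof.
move=> mp sp; apply: (local_integralM p_prime); last first.
  exact/local_integralV_nat/prime_ndvd_fact.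
apply: (local_integral_prod p_prime) => i.
apply: (local_integralD p_prime) => //; apply: (local_integralN p_prime).
exact: local_integral_nat.
Qed.

Lemma local_integral_pochhammer (s : C) (m : nat) :
  local_integral p s -> local_integral p (pochhammer s m).
Proof.
move=> sp; apply: (local_integral_prod p_prime) => i.
by apply: (local_integralD p_prime) => //; apply: local_integral_nat.
Qed.

Lemma local_integral_binomial_series (z : fps C) (s : C) (n : nat) :
  (n < p)%N -> local_integral p s ->
  (forall i, (i <= n)%N -> local_integral p (z i)) ->
  forall i, (i <= n)%N -> local_integral p (fps_binomial z s i).
Proof.
move=> np sp zp.
apply: (fps_comp_closed (local_integral_nat R p_prime)
  (local_integral_sum p_prime) (local_integralM p_prime)) => // i le_in.
by apply: local_integral_gbinomial => //; apply: leq_ltn_trans np.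
Qed.

(** Denominators come only from 192 = 2^6 * 3 and from the factorials in the binomial series of
    exponent -1; the bounds on p exclude both. *)
Lemma local_integral_Kinv (n i : nat) :
  (3 < p)%N -> (n < p)%N -> (i <= n)%N -> local_integral p (@Kinv_series C i).
Proof.
move=> p3 np le_in.
have LD := @local_integralD R p p_prime.
have LM := @local_integralM R p p_prime.
have LN := @local_integralN R p p_prime.
have Ln := @local_integral_nat R p p_prime.
have mulL := fps_mul_closed (@local_integral_sum R p p_prime) LM.
have E2L k : local_integral p (@E2_series C k).
  rewrite /E2_series; case: ifP => _; first exact: (Ln 1%N).
  by rewrite mulNr; apply/LN/LM.
have E4L k : local_integral p (@E4_series C k).
  by rewrite /E4_series; case: ifP => _; [exact: (Ln 1%N) | apply: LM].
have GL k : local_integral p (@G_series C k).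
  apply: LD; first exact: LN.
  by apply: LM => //; case: ifP => _ //; apply: (Ln 0%N).
have G2L k : local_integral p (fps_mul (@G_series C) (@G_series C) k).
  by apply: (mulL k).
have scL (x : C) : local_integral p x -> local_integral p (-1 * x).
  by move=> xL; rewrite mulN1r; apply: LN.
rewrite /Kinv_series; apply: LM.
  apply: local_integralV_nat; apply/negP.
  rewrite (_ : 192 = 2 ^ 6 * 3)%N //.
  rewrite Euclid_dvdM // Euclid_dvdX // !dvdn_prime2 //.
  by move=> /orP[/andP[/eqP]|/eqP]; lia.
apply: (mulL n) le_in => k le_kn.
  by apply: LD => //; apply: scL.
apply: (@local_integral_binomial_series _ _ n) => // [|j _].
  exact/LN/(Ln 1%N).
by apply: LD => //; apply: scL; apply: Ln.
Qed.

(** * Coefficients of index at most K for a fixed prime p = u + K v *)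

Section Coefficients.
Variables (A B r : C) (u v : int) (K : nat).
(** The bound is on [K.+1] because the q^K coefficient of [Y_series] is taken from the q^(K+1)
    coefficient of [Kinv_series]. *)
Hypotheses (p3 : (3 < p)%N) (Kp : (K.+1 < p)%N) (K0 : (0 < K)%N).
Hypotheses (AL : local_integral p A) (rL : local_integral p r).
Hypothesis AV :
  forall i : nat, A + i%:R != 0 /\ local_integral p (A + i%:R)^-1.
Hypothesis A2V :
  forall i : nat, 2^-1 + A + i%:R != 0 /\ local_integral p (2^-1 + A + i%:R)^-1.
Hypotheses (AB : A - B = u%:~R / v%:~R) (pv : ~~ (p %| `|v|)%N).
Hypothesis pK : p%:Z = u + K%:Z * v.

Let LD := @local_integralD R p p_prime.
Let LM := @local_integralM R p p_prime.
Let LN := @local_integralN R p p_prime.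
Let Ln := @local_integral_nat R p p_prime.
Let Ls := @local_integral_sum R p p_prime.
Let Lprod := @local_integral_prod R p p_prime.

Let v0 : v%:~R != 0 :> C.
Proof. by rewrite intr_eq0; apply: contraNneq pv => ->. Qed.

Let gamma_factor (i : nat) :
  1 + A - B + i%:R = (u + i.+1%:Z * v)%:~R / v%:~R.
Proof.
rewrite -[1 + A - B]addrA AB rmorphD rmorphM /= -pmulrn -natr1.
by field.
Qed.

(** Subtracting from p = u + K v leaves (K - i - 1) v, where 0 < K - i - 1 < p and p does not divide
    v. *)
Let gamma_factor_ndvd (i : nat) : (i.+1 < K)%N ->
  ~~ (p %| `|(u + i.+1%:Z * v)%R|)%N.
Proof.
move=> iK.
have -> : u + i.+1%:Z * v = p%:Z - (K - i.+1)%:Z * v.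
  by rewrite pK -subzn ?(ltnW iK) //; ring.
apply/negP => h.
have : (p%:Z %| (K - i.+1)%:Z * v)%Z.
  by rewrite -[_ * v](subKr p%:Z); apply: rpredB; [exact: dvdzz | exact: h].
rewrite dvdzE abszM Euclid_dvdM // (negbTE pv) orbF /= => /dvdn_leq.
by lia.
Qed.

Let half_local : local_integral p (2^-1 + A).
Proof.
by apply: LD => //; apply: local_integralV_nat; rewrite gtnNdvd //; lia.
Qed.

Let pochhammerV (x : C) m : (forall i : 'I_m, local_integral p (x + i%:R)^-1) ->
  local_integral p (pochhammer x m)^-1.
Proof. by move=> xV; rewrite /pochhammer -prodfV; apply: Lprod. Qed.

Let factV m : (m <= K)%N -> local_integral p (m`!%:R^-1 : C).
Proof.
move=> mK; apply: local_integralV_nat.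
by apply: prime_ndvd_fact; lia.
Qed.

Let gammaV i : (i.+1 < K)%N -> local_integral p (1 + A - B + i%:R)^-1.
Proof.
move=> iK; rewrite gamma_factor invf_div; apply: LM.
  exact: (local_integral_int R p_prime).
by apply: (local_integralV_int R p_prime); apply: gamma_factor_ndvd.
Qed.

Let hyp_local m : (m < K)%N ->
  local_integral p (hyp2F1 A (2^-1 + A) (1 + A - B) m).
Proof.
move=> mK; apply: LM.
  by apply: LM; apply: local_integral_pochhammer.
rewrite invfM; apply: LM; last by apply: factV; apply: ltnW.
by apply: pochhammerV => i; apply: gammaV; have := ltn_ord i; lia.
Qed.

(** This is p times the hypergeometric coefficient of index K; the next lemmas show that it is a
    unit at p. *)
Let c := pochhammer A K * pochhammer (2^-1 + A) K * v%:~R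
  * (pochhammer (1 + A - B) K.-1)^-1 * K`!%:R^-1.

(* The [K]-th factor of the Pochhammer symbol [(1 + A - B)_K] is [p / v]. *)
Let hypK : hyp2F1 A (2^-1 + A) (1 + A - B) K = c / p%:R.
Proof.
have gK : pochhammer (1 + A - B) K
    = pochhammer (1 + A - B) K.-1 * (p%:R / v%:~R).
  rewrite -{1}(prednK K0) /pochhammer big_ord_recr /= gamma_factor.
  by rewrite prednK // -pK -pmulrn.
rewrite /hyp2F1 gK /c !invfM invrK; ring.
Qed.

Let c_local : local_integral p c.
Proof.
apply: LM; last exact: factV.
apply: LM; last first.
  by apply: pochhammerV => i; apply: gammaV; have := ltn_ord i; lia.
apply: LM; last exact: (local_integral_int R p_prime).
by apply: LM; apply: local_integral_pochhammer.
Qed.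

(** Invertibility of the factors A + i and 1/2 + A + i is what prevents the numerator from
    cancelling the p in the denominator. *)
Let cV_local : local_integral p c^-1.
Proof.
rewrite /c !invfM !invrK; apply: LM; last exact: Ln.
apply: LM; last first.
  apply: local_integral_pochhammer; rewrite -addrA AB; apply: LD (Ln 1%N) _.
  apply: LM; first exact: (local_integral_int R p_prime).
  exact: (local_integralV_int R p_prime).
apply: LM; last exact: (local_integralV_int R p_prime).
by apply: LM; apply: pochhammerV => i; [have [] := AV i | have [] := A2V i].
Qed.

Let Kinv_local i : (i <= K.+1)%N -> local_integral p (@Kinv_series C i).
Proof. exact: local_integral_Kinv. Qed.

Let z := fps_scale 64 (@Kinv_series C).
Let z_local i : (i <= K)%N -> local_integral p (z i).
Proof. by move=> iK; apply: LM => //; apply/Kinv_local/leqW. Qed.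

Let H := fps_comp (hyp2F1 A (2^-1 + A) (1 + A - B)) z.
Let H_local i : (i < K)%N -> local_integral p (H i).
Proof.
move=> iK; apply: (fps_comp_closed Ln Ls LM (n := K.-1)) => [j jK|j jK|].
- by apply: hyp_local; lia.
- by apply: z_local; lia.
- by lia.
Qed.

(** Since z = 64 q + O(q^2), the term m = K of the composition contributes 64^K times the
    coefficient with denominator p; all terms m < K are integral at p. *)
Let HK : exists2 w, local_integral p w & H K = w + c / p%:R * 64 ^+ K.
Proof.
exists (\sum_(m < K) hyp2F1 A (2^-1 + A) (1 + A - B) m * fps_exp z m K).
  apply: Ls => m; apply: LM; first exact: hyp_local.
  by apply: (fps_exp_closed Ln Ls LM (n := K)) => // i; apply: z_local.
rewrite /H /fps_comp big_ord_recr /= hypK fps_exp_leading.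
  by rewrite /z /fps_scale Kinv_series1 mulr1.
by rewrite /z /fps_scale Kinv_series0 mulr0.
Qed.

Let W := fps_mul (fps_binomial (@Y_series C) (A - r))
                 (fps_binomial (fps_scale (- 64) (@Kinv_series C)) r).
Let W_local i : (i <= K)%N -> local_integral p (W i).
Proof.
move=> iK; apply: (fps_mul_closed Ls LM (n := K)) (iK) => j jK.
  apply: (@local_integral_binomial_series _ _ K) => //; first exact: ltnW.
    by apply: LD => //; apply: LN.
  by move=> k kK; apply: LD; [exact: Kinv_local | apply: LN].
apply: (@local_integral_binomial_series _ _ K) => // [|k kK]; first exact: ltnW.
by rewrite /fps_scale mulNr; apply: LN; apply: z_local.
Qed.

(** The prefactor [W] has constant term 1, so [H K] enters with coefficient 1; every other term of
    the convolution uses [H] at an index below K. *)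
Let hcoefE : exists2 w, local_integral p w &
  hcoef A B r K = w + c / p%:R * 64 ^+ K.
Proof.
have [w wp HKE] := HK.
exists (w + \sum_(i < K) W i.+1 * H (K - i.+1)%N).
  apply: LD => //; apply: Ls => i; apply: LM.
    by apply: W_local.
  by apply: H_local; lia.
rewrite /hcoef -/W -/z -/H {1}/fps_mul big_ord_recl subn0 HKE.
have -> : W 0%N = 1.
  by rewrite /W /fps_mul big_ord_recl big_ord0 !fps_binomial0 mulr1 addr0.
by rewrite mul1r addrAC.
Qed.

Lemma hcoef_local_integral J : (J < K)%N -> local_integral p (hcoef A B r J).
Proof.
move=> JK; rewrite /hcoef -/W -/z -/H.
apply: (fps_mul_closed Ls LM (n := K.-1)) => [j jK|j jK|].
- by apply: W_local; lia.
- by apply: H_local; lia.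
- by lia.
Qed.

Lemma hcoef_divides_denominator : divides_denominator p (hcoef A B r K).
Proof.
have p0 : p%:R != 0 :> C by rewrite pnatr_eq0 -lt0n prime_gt0.
have [w wp ->] := hcoefE.
apply: not_local_integral_divides_denominator => //.
  have -> : p%:R * (w + c / p%:R * 64 ^+ K) = p%:R * w + c * 64 ^+ K by field.
  by apply: LD; apply: LM => //; apply: (local_integralX p_prime).
move=> hp; suff : local_integral p (p%:R^-1 : C).
  exact: (@not_local_integralV_prime R p p_prime).
have c0 : c != 0.
  rewrite /c !mulf_neq0 // ?invr_neq0 ?pnatr_eq0 -?lt0n ?fact_gt0 //.
  - by apply/prodf_neq0 => i _; have [] := AV i.
  - by apply/prodf_neq0 => i _; have [] := A2V i.
  - apply/prodf_neq0 => i _; rewrite gamma_factor mulf_neq0 ?invr_neq0 //.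
    rewrite intr_eq0; have /gamma_factor_ndvd : (i.+1 < K)%N.
      by have := ltn_ord i; lia.
    by apply: contraNneq => ->.
(* Solving for 1/p divides only by [c] and powers of 64, all units at p, so integrality of h(K)
   would pass to 1/p. *)
have -> : p%:R^-1 = ((w + c / p%:R * 64 ^+ K) - w) * c^-1 * (64^-1) ^+ K :> C.
  rewrite exprVn; field; rewrite c0 p0 expf_neq0 // pnatr_eq0.
apply: LM; last first.
  apply: (local_integralX p_prime); apply: local_integralV_nat.
  by rewrite (_ : 64 = 2 ^ 6)%N // Euclid_dvdX // dvdn_prime2 //; lia.
by apply: LM => //; apply: LD => //; apply: LN.
Qed.

End Coefficients.
End HcoefDenominators.

(** * Quadratic fields *)

Section QuadraticFields.
Variable R : realType.
Local Notation C := R[i].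

Lemma evalQ_quadratic (M : int) (s : C) (f : {poly rat}) :
  s ^+ 2 = M%:~R -> exists x y : rat, evalQ f s = ratr x + ratr y * s.
Proof.
move=> sM; elim/poly_ind: f => [|f c [x [y IH]]].
  by exists 0, 0; rewrite /evalQ !rmorph0 horner0 mul0r addr0.
exists (y * M%:~R + c), x.
rewrite /evalQ rmorphD rmorphM /= map_polyX map_polyC /=.
rewrite hornerD hornerMX hornerC -/(evalQ f s) IH rmorphD rmorphM /= ratr_int.
by rewrite -sM; ring.
Qed.

Lemma Qadjoin_quadratic (M : int) (s z : C) :
  s ^+ 2 = M%:~R -> Qadjoin s z -> exists x y : rat, z = ratr x + ratr y * s.
Proof.
move=> sM [f [d [d0 ->]]].
have [x [y ->]] := evalQ_quadratic f sM.
have [x' [y' dE]] := evalQ_quadratic d sM.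
move: d0; rewrite dE => d0.
have [t [w tw]] : exists t w : rat,
    (ratr x' + ratr y' * s)^-1 = ratr t + ratr w * s.
  (* [s] may be rational here, so the conjugate can vanish; the denominator is then the rational
     number 2 x'. *)
  have [c0|c0] := eqVneq (ratr x' - ratr y' * s) 0.
    exists (x' *+ 2)^-1, 0; rewrite rmorph0 mul0r addr0 fmorphV; congr (_^-1).
    rewrite rmorphMn /= mulr2n; congr (_ + _).
    by apply/eqP; rewrite eq_sym -subr_eq0 c0.
  pose n := x' ^+ 2 - M%:~R * y' ^+ 2.
  have nE : ratr n = (ratr x' + ratr y' * s) * (ratr x' - ratr y' * s).
    by rewrite /n rmorphB !rmorphM /= ratr_int -sM; ring.
  exists (x' / n), (- y' / n); rewrite !rmorphM rmorphN !fmorphV /= nE.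
  by field; rewrite d0 c0.
exists (x * t + y * w * M%:~R), (x * w + y * t).
by rewrite tw !rmorphD !rmorphM /= ratr_int -sM; ring.
Qed.

Lemma Qadjoin_ratr (q : rat) (z : C) :
  Qadjoin (ratr q) z -> exists t, z = ratr t.
Proof.
have ev f : evalQ f (ratr q : C) = ratr f.[q] by rewrite /evalQ horner_map.
by move=> [f [d [_ ->]]]; exists (f.[q] / d.[q]); rewrite !ev fmorph_div.
Qed.

Lemma Qdim2_irrational (r : C) : Qdim (Qadjoin r) 2 -> ~ exists q, r = ratr q.
Proof.
move=> [e [eE eF]] [q rq].
have sum2 (t : 'I_2 -> rat) :
    \sum_i ratr (t i) * e i = ratr (t 0) * e 0 + ratr (t 1) * e 1.
  rewrite !big_ord_recl big_ord0 addr0.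
  by congr (_ + ratr (t _) * e _); apply: val_inj.
have erat i : exists t, e i = ratr t.
  apply: (@Qadjoin_ratr q); rewrite -rq; apply/eE.
  exists (fun j => (j == i)%:R).
  rewrite (bigD1 i) //= eqxx rmorph1 mul1r big1 ?addr0 //.
  by move=> j /negbTE ->; rewrite rmorph0 mul0r.
have [t0 e0] := erat 0; have [t1 e1] := erat 1.
(* Two rational numbers are dependent over Q: t1 e0 - t0 e1 = 0. Independence gives t0 = 0, hence e0
   = 0, which contradicts independence again. *)
pose t (i : 'I_2) := if i == 0 then t1 else - t0.
have tF := eF t; rewrite sum2 /t /= e0 e1 rmorphN in tF.
have {}tF : forall i, t i = 0 by apply: tF; ring.
have := tF 1; rewrite /t /= => /eqP; rewrite oppr_eq0 => /eqP t00.
have := eF (fun i => (i == 0)%:R).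
rewrite sum2 /= e0 t00 !rmorph0 mulr0 mul0r addr0 => /(_ erefl 0) /eqP.
by rewrite oner_eq0.
Qed.

(** The integers [Y] and [d] are fixed and nonzero, so every sufficiently large prime is prime to
    both. *)
Lemma quadratic_common_denominator (s : C) (x y : rat) : y != 0 ->
  exists (X Y : int) (d : nat), [/\ (0 < d)%N, Y != 0 &
    ratr x + ratr y * s = (X%:~R + Y%:~R * s) / d%:R].
Proof.
move=> y0.
exists (numq x * denq y), (numq y * denq x), (`|denq x| * `|denq y|)%N.
split; first by rewrite muln_gt0 !absz_gt0 !denq_neq0.
  by rewrite mulf_neq0 ?numq_eq0 ?denq_neq0.
have dx : (denq x)%:~R != 0 :> C by rewrite intr_eq0 denq_neq0.
have dy : (denq y)%:~R != 0 :> C by rewrite intr_eq0 denq_neq0.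
have -> : (`|denq x| * `|denq y|)%N%:R = (denq x)%:~R * (denq y)%:~R :> C.
  by rewrite natrM !pmulrn !gtz0_abs ?denq_gt0.
by rewrite !rmorphM /= /ratr; field; rewrite dx dy.
Qed.

End QuadraticFields.

(** * From the modular setting to integrality at large primes *)

Theorem theorem5p22 (R : realType)
  (rho : 'M[int]_2 -> 'M[R[i]]_2)
  (hrho : is_representation rho) (hirr : is_irreducible rho)
  (k0 : int) (hk0 : is_least_weight rho k0)
  (F : R[i] -> 'cV[R[i]]_2) (hF : is_vvmf rho k0 F) (hF0 : nonzero_on_H F)
  (a b c : R[i]) (hode : satisfies_ode k0 a b c F)
  (r : R[i]) (hr : r ^+ 2 - (a + 3^-1) * r + b + 4 * c = 0)
  (hT : exists2 n : nat, (0 < n)%N & rho Tmx ^+ n = 1)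
  (hc : exists c' : rat, c = ratr c')
  (hr2 : Qdim (Qadjoin r) 2)
  (X : 'M[R[i]]_2) (hX : X \in unitmx)
  (m : 'I_2 -> R[i])
  (hXT : X *m rho Tmx *m invmx X = diag_mx (\row_j expC (twopii R * m j)))
  (hm : `|m 0| <= `|m 1|)
  (lambda l : 'I_2 -> R[i]) (hlambda : forall i, lambda i != 0)
  (hl : forall i, has_leading_term (fun tau => (X *m F tau) i 0)
                    (lambda i) (k0%:~R / 12 + l i))
  (A B : R[i]) (hA : A = r + l 0) (hB : B = r + l 1)
  (u v : int) (huv : A - B = u%:~R / v%:~R) (hv : 1 < v)
  (hcop : coprimez u v)
  (M : int) (hM : squarefree M) (hrM : Qadjoin r = Qadjoin (sqrtC M%:~R))
  (hS : infinite_set (primesS M u v)) :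
  (exists K0 : nat, forall K p : nat, (K0 <= K)%N ->
     p%:Z = u + K%:Z * v -> primesS M u v p ->
     divides_denominator p (hcoef A B r K) /\
     (forall J : nat, (0 < J < K)%N -> p_integral p (hcoef A B r J))) /\
  (exists p0 : nat, forall p : nat, (p0 <= p)%N -> primesS M u v p ->
     exists2 K : nat, (0 < K)%N & divides_denominator p (hcoef A B r K)).
Proof.
set s := sqrtC M%:~R in hrM.
have sM : s ^+ 2 = M%:~R by exact: sqrtCK.
have [n n0 rhoTn] := hT.
have [q l0q] : exists q : rat, l 0 = ratr q.
  have [|q' q'E] := leading_exponent_rational n0 (hlambda 0) (hl 0).
    by move=> tau Htau; rewrite (vvmf_translation n hF Htau) rhoTn mul1mx.
  exists (q' - k0%:~R / 12).
  rewrite rmorphB /= -q'E fmorph_div /= ratr_int ratr_nat.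
  by rewrite addrC addKr.
have [x [y rE]] : exists x y : rat, r = ratr x + ratr y * s.
  apply: (Qadjoin_quadratic sM); rewrite -hrM.
  exists 'X, 1.
  by rewrite /evalQ rmorph1 hornerC oner_eq0 map_polyX hornerX divr1.
have y0 : y != 0.
  apply/eqP => y0; apply: (Qdim2_irrational hr2); exists x.
  by rewrite rE y0 rmorph0 mul0r addr0.
(* A = r + l_1 has rational part x + q and keeps the nonzero coefficient y of [s]. *)
have [XA [YA [d [d0 YA0 AE]]]] := quadratic_common_denominator s (x + q) y0.
have {}AE : A = (XA%:~R + YA%:~R * s) / d%:R.
  by rewrite -AE hA rE l0q rmorphD /=; ring.
have dC : d%:R != 0 :> R[i] by rewrite pnatr_eq0 -lt0n.
(* A prime above [P0] exceeds 3 and divides none of [d], [YA], [denq q], [v]. Since v >= 2, K >= K0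
   gives p >= 2 K - |u| >= K + P0, hence p > P0 and p > K + 1. *)
pose P0 := (d + `|YA| + `|denq q| + `|v| + 4)%N.
pose K0 := (P0 + `|u|)%N.
have main (K p : nat) : (K0 <= K)%N -> p%:Z = u + K%:Z * v -> primesS M u v p ->
    divides_denominator p (hcoef A B r K) /\
    (forall J : nat, (0 < J < K)%N -> p_integral p (hcoef A B r J)).
  move=> leK pK [p_prime _ nonM _].
  have Kv : K%:Z * 2 <= K%:Z * v by rewrite ler_wpM2l.
  have K_gt0 : (0 < K)%N by rewrite /K0 /P0 in leK; lia.
  have [p_gt Kp] : (P0 < p)%N /\ (K.+1 < p)%N.
    by rewrite /K0 /P0 in leK *; lia.
  have [dp Yp qp vp p3] :
      [/\ (d < p)%N, (`|YA| < p)%N, (`|denq q| < p)%N, (`|v| < p)%N & (3 < p)%N].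
    by clear - p_gt; rewrite /P0 in p_gt; split; lia.
  have pd : ~~ (p %| d)%N by rewrite gtnNdvd.
  have pY : ~~ (p %| `|YA|)%N by rewrite gtnNdvd ?absz_gt0.
  have pq : ~~ (p %| `|denq q|)%N by rewrite gtnNdvd ?absz_gt0 ?denq_neq0.
  have pv : ~~ (p %| `|v|)%N.
    by rewrite gtnNdvd // absz_gt0 gt_eqF // (lt_trans _ hv).
  have p2 : ~~ (p %| 2)%N by rewrite gtnNdvd // ltnW.
  have AL : local_integral p A.
    rewrite AE; apply: (local_integralM p_prime); last first.
      exact: local_integralV_nat.
    apply: (local_integralD p_prime); first exact: local_integral_int.
    apply: (local_integralM p_prime); first exact: local_integral_int.
    exact: (local_integral_sqrt p_prime sM).
  have rL : local_integral p r.
    have -> : r = A - ratr q by rewrite hA l0q addrK.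
    apply: (local_integralD p_prime) => //; apply: (local_integralN p_prime).
    exact: local_integral_rat.
  have unit (g h : int) (e : nat) : ~~ (p %| `|h|)%N -> (0 < e)%N ->
      (g%:~R + h%:~R * s) / e%:R != 0 /\
      local_integral p ((g%:~R + h%:~R * s) / e%:R)^-1.
    move=> ph e0.
    have [z0 zV] := local_integralV_quadratic p_prime g nonM sM ph.
    split; first by rewrite mulf_neq0 // invr_neq0 // pnatr_eq0 -lt0n.
    rewrite invf_div; apply: (local_integralM p_prime) => //.
    exact: local_integral_nat.
  (* Adding i, or 1/2 + i below, changes only the rational part: the coefficient of [s] stays [YA],
     or 2 [YA] over 2 [d], so one bound on p serves all i. *)
  have AV (i : nat) : A + i%:R != 0 /\ local_integral p (A + i%:R)^-1.
    have -> : A + i%:R = ((XA + (i * d)%:Z)%:~R + YA%:~R * s) / d%:R.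
      by rewrite AE rmorphD /= -pmulrn natrM; field.
    exact: unit.
  have A2V (i : nat) :
      2^-1 + A + i%:R != 0 /\ local_integral p (2^-1 + A + i%:R)^-1.
    have -> : 2^-1 + A + i%:R
        = ((2 * XA + (d + 2 * i * d)%:Z)%:~R + (2 * YA)%:~R * s) / (2 * d)%:R.
      rewrite AE rmorphD !rmorphM /= -!pmulrn !natrD !natrM; field.
      by rewrite dC andbT -mulr2n mulrn_eq0 (negbTE dC).
    by apply: unit; rewrite ?muln_gt0 // abszM Euclid_dvdM // negb_or p2.
  split.
    exact: (hcoef_divides_denominator p_prime p3 Kp K_gt0 AL rL AV A2V huv pv pK).
  move=> J /andP[_ JK]; apply: local_integral_p_integral.
  exact: (hcoef_local_integral p_prime p3 Kp K_gt0 AL rL huv pv pK JK).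
split; first by exists K0.
(* For p = u + k v this bound gives k v >= p - |u| >= K0 v, so k >= K0 > 0. *)
exists (`|u| + K0 * `|v|)%N => p p_ge pS.
have [_ _ _ /eqP] := pS; rewrite eqz_mod_dvd => /dvdzP[k kE].
have v_gt0 : 0 < v by apply: lt_trans hv.
have k_ge : K0%:Z <= k.
  rewrite -(ler_pM2r v_gt0) -kE -{1}(gtz0_abs v_gt0) -PoszM.
  by clear - p_ge; lia.
have K0_gt0 : (0 < K0)%N by rewrite /K0 /P0; lia.
have kE' : p%:Z = u + `|k|%N%:Z * v by rewrite gez0_abs -?kE; [ring | lia].
exists `|k|%N; first by lia.
by apply: (main `|k|%N p _ kE' pS).1; lia.
Qed.
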